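(* Let $G=(V,E)$ be a connected graph with $\kappa(G)=1$. Let $M$ be any well-signed $G$-matrix with exactly one negative eigenvalue and with corank $1$. Let $u\in\mathbb{R}^V$ be a nonzero vector in $\ker M$ and let $\pi\in\mathbb{R}^V$ be an entrywise positive eigenvector of $M$ belonging to its negative eigenvalue. Then the map $V\to\mathbb{R}$, $i\mapsto u_i/\pi_i$, extended to edges by mapping each edge to the segment between the images of its endpoints, is an embedding of $G$ in the line.
   Context: $G=(V,E)$ is a finite simple undirected graph. A $G$-matrix is a symmetric real $V\times V$ matrix $M$ with $M_{ij}=0$ whenever $i,j$ are distinct nonadjacent nodes (no condition on diagonal entries). It is well-signed if $M_{ij}<0$ whenever $i,j$ are distinct adjacent nodes. The corank of $M$ is $\dim\ker M$, and eigenvalues are counted with multiplicity. $\kappa(G)$ is the largest $d$ for which there exists a well-signed $G$-matrix with exactly one negative eigenvalue and with corank $d$. (For connected $G$, an entrywise positive eigenvector for the smallest eigenvalue of a well-signed $G$-matrix exists by Perron--Frobenius.) An embedding of $G$ in the line means that distinct nodes have distinct images and the segments of distinct edges meet only at images of common endpoints, and contain node images only at their own endpoints. *)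

(* Defs.v *)
From HB Require Import structures.
From mathcomp Require Import all_boot all_order all_algebra.
From mathcomp Require Import boolp reals.

Set Implicit Arguments.
Unset Strict Implicit.
Unset Printing Implicit Defensive.

Import Order.TTheory GRing.Theory Num.Theory.

Local Open Scope ring_scope.

(* A simple graph on the finite type V is a symmetric irreflexive e : rel V.
   V x V matrices and vectors indexed by V are square matrices and column
   vectors of size #|V|, read through the bijection enum_rank : V -> 'I_#|V|. *)

Definition mx_entry (R : realType) (V : finType) (M : 'M[R]_#|V|) (i j : V) : R :=
  M (enum_rank i) (enum_rank j).

Definition vec_entry (R : realType) (V : finType) (u : 'cV[R]_#|V|) (i : V) : R :=
  u (enum_rank i) 0.

Definition connected_graph (V : finType) (e : rel V) : Prop :=
  forall i j : V, connect e i j.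

Definition graph_matrix (R : realType) (V : finType) (e : rel V)
    (M : 'M[R]_#|V|) : Prop :=
  M^T = M /\ (forall i j : V, i != j -> ~~ e i j -> mx_entry M i j = 0).

Definition well_signed (R : realType) (V : finType) (e : rel V)
    (M : 'M[R]_#|V|) : Prop :=
  graph_matrix e M /\ (forall i j : V, i != j -> e i j -> mx_entry M i j < 0).

(* kermx is the kernel of the action on row vectors, so the kernel
   {v | M *m v = 0} on column vectors is obtained from the transpose. *)
Definition corank (R : realType) (n : nat) (M : 'M[R]_n) : nat :=
  \rank (kermx M^T).

(* s lists the eigenvalues with multiplicity; such an s, unique up to
   permutation, exists for every real symmetric matrix. *)
Definition one_negative_eigenvalue (R : realType) (n : nat) (M : 'M[R]_n) :
    Prop :=
  exists2 s : seq R, char_poly M = \prod_(a <- s) ('X - a%:P)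
                   & count (fun a => a < 0) s = 1%N.

(* The bound d <= #|V| is no restriction, as a corank is at most #|V|.  The
   maximum ranges over the empty set, and is 0, only if V is empty. *)
Definition kappa (R : realType) (V : finType) (e : rel V) : nat :=
  \max_(d < #|V|.+1 | `[< exists M : 'M[R]_#|V|,
      [/\ well_signed e M, one_negative_eigenvalue M & corank M = d] >]) d.

Definition in_segment (R : realType) (a b z : R) : Prop :=
  Num.min a b <= z <= Num.max a b.

(* The edge joining i and j is identified by the set [set i; j] of its ends. *)
Definition line_embedding (R : realType) (V : finType) (e : rel V)
    (x : V -> R) : Prop :=
  [/\ injective x,
      forall i j k l : V, e i j -> e k l -> [set i; j] != [set k; l] ->
        forall z : R, in_segment (x i) (x j) z -> in_segment (x k) (x l) z ->
        exists2 v : V, v \in [set i; j] :&: [set k; l] & z = x v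
    & forall i j k : V, e i j -> in_segment (x i) (x j) (x k) ->
        k \in [set i; j]].

(* Main.v *)
Require Import Defs.
From HB Require Import structures.
From mathcomp Require Import all_boot all_order all_algebra.
From mathcomp Require Import boolp reals.
From mathcomp Require Import complex.
From mathcomp Require Import ring lra.

Set Implicit Arguments.
Unset Strict Implicit.
Unset Printing Implicit Defensive.

Import Order.TTheory GRing.Theory Num.Theory.

Local Open Scope ring_scope.

(** Put x_i = u_i / p_i.  Call a node b a separator of nodes a and c when every
    path from a to c passes through b.

    The hypothesis on kappa forces G to be a path, in the following form
    ([linear_triples]): among any three nodes, one separates the other two.
    Suppose on the contrary that a, b, c are pairwise joined by paths avoiding
    the third node.  Take a positive definite well-signed G-matrix L, and
    eliminate all nodes other than a, b, c; the resulting 3 x 3 Schur complement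
    has negative off-diagonal entries, because each of the three paths carries
    some current.  Changing the diagonal entries of L at a, b, c changes only the
    diagonal of the Schur complement, which can thus be turned into minus the
    square of a positive vector: a negative semidefinite matrix of rank one.
    The modified L has one negative eigenvalue and corank two ([corank_two]),
    whence kappa >= 2.

    The geometric claim is that if b separates a from c then x_b lies strictly
    between x_a and x_c ([separator_between]).  Replacing u by -u if necessary,
    it is enough to exclude x_a, x_c >= x_b.
    - If x_b < 0, put z = u - x_b p, which vanishes at b and satisfies M z < 0
      entrywise.  The positive part of z on the component of a in G - b, and the
      one on the component of c, are two M-orthogonal vectors on which the
      quadratic form of M is negative ([truncation_neg]).  This contradicts the
      fact that M has a single negative eigenvalue ([separator_nonneg]).
    - So x is nonnegative at every separator of a and c where it is at most x_a
      and x_c.  Take a separator k with x_k minimal.  Each neighbour of k other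
      than a and c is again a separator of a and c, so x has a local minimum at
      k; as x_k >= 0, the k-th rows of M u = 0 and M p = lam p force u to vanish
      at k and at all its neighbours.  Since degrees are at most two, the rows of
      M u = 0 propagate the zeros over the whole graph ([zero_neighborhood]), a
      contradiction ([separator_not_low]).

    Applied to the triple formed by the ends of an edge and a third node, the
    claim keeps the image of the third node outside the image of the edge, and
    with injectivity this already gives an embedding
    ([line_embedding_criterion]). *)

(** * Inertia of real symmetric matrices *)

Definition bilin (R : pzRingType) n (A : 'M[R]_n) (x y : 'cV[R]_n) : R :=
  (x^T *m A *m y) 0 0.

Lemma bilinE (R : pzRingType) n (A : 'M[R]_n) (x y : 'cV[R]_n) :
  bilin A x y = \sum_i x i 0 * (A *m y) i 0.
Proof. by rewrite /bilin -mulmxA mxE; apply: eq_bigr => i _; rewrite mxE. Qed.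

Lemma bilinC (R : comPzRingType) n (A : 'M[R]_n) x y :
  A^T = A -> bilin A x y = bilin A y x.
Proof.
move=> Asym; rewrite /bilin.
have -> : x^T *m A *m y = (y^T *m A *m x)^T by rewrite !trmx_mul trmxK Asym mulmxA.
by rewrite mxE.
Qed.

Lemma bilin_comb (R : comPzRingType) n (A : 'M[R]_n) (x y : 'cV[R]_n) a b :
  A^T = A ->
  bilin A (a *: x + b *: y) (a *: x + b *: y) =
  a ^+ 2 * bilin A x x + (a * b *+ 2) * bilin A x y + b ^+ 2 * bilin A y y.
Proof.
move=> Asym; have := bilinC y x Asym; rewrite /bilin => eqyx.
have -> : (a *: x + b *: y)^T = a *: x^T + b *: y^T.
  by apply/matrixP => i j; rewrite !mxE.
rewrite mulmxDr !mulmxDl -!scalemxAr -!scalemxAl.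
move: (x^T *m _ *m x) (x^T *m _ *m y) (y^T *m _ *m x) (y^T *m _ *m y) eqyx.
by move=> X Y Z W eqZ; rewrite !mxE eqZ; ring.
Qed.

Section Spectral.
Variables (R : realType) (n : nat).
Local Notation C := (R[i]).
Local Notation toC := (real_complex R).

Lemma char_poly_similar (F : fieldType) (P A B : 'M[F]_n) :
  P \in unitmx -> P *m A = B *m P -> char_poly A = char_poly B.
Proof.
move=> Punit eqPA; have detP0 : \det (map_mx polyC P) != 0.
  by rewrite det_map_mx polyC_eq0 -unitfE -unitmxE.
apply: (mulfI detP0); rewrite /char_poly -det_mulmx mulrC -det_mulmx.
congr (\det _); rewrite /char_poly_mx mulmxBr mulmxBl -!map_mxM eqPA.
by rewrite scalar_mxC.
Qed.

(** The spectral theorem for Hermitian matrices, in the form needed over the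
    reals: for the complex vector c = x + i y, the Hermitian form of A at c is the
    sum of the two real forms at x and y, since the cross terms cancel by
    symmetry of A. *)
Lemma symmetric_diagonalization (A : 'M[R]_n) : A^T = A ->
  exists (P : 'M[C]_n) (d : 'I_n -> R),
  [/\ P \in unitmx, char_poly A = \prod_i ('X - (d i)%:P) &
      forall x y : 'cV[R]_n, toC (bilin A x x + bilin A y y) =
        \sum_i toC (d i) *
          `|(P *m (map_mx toC x + 'i%C *: map_mx toC y)) i 0| ^+ 2].
Proof.
move=> Asym; pose AC := map_mx toC A.
have AC_herm : AC \is hermsymmx.
  apply: realsym_hermsym.
    by apply/is_hermitianmxP; rewrite expr0 scale1r map_mx_id // /AC map_trmx Asym.
  by apply/mxOverP => i j; rewrite mxE; apply/complex_realP; exists (A i j).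
set P := spectralmx AC; set D := spectral_diag AC.
have Punit : P \in unitmx := spectral_unit AC.
have /orthomx_spectralP AC_E := hermitian_normalmx AC_herm.
rewrite -/P -/D in AC_E.
pose d i := complex.Re (D 0 i).
have DE i : D 0 i = toC (d i).
  by rewrite RRe_real // (mxOverP (hermitian_spectral_diag_real AC_herm)).
exists P, d; split=> //.
  apply: (map_poly_inj toC); rewrite map_char_poly -/AC.
  have -> : char_poly AC = char_poly (diag_mx D).
    by apply: (char_poly_similar Punit); rewrite {1}AC_E !mulmxA mulmxV // mul1mx.
  rewrite char_poly_trig ?diag_mx_is_trig // rmorph_prod /=.
  apply: eq_bigr => i _.
  by rewrite rmorphB /= map_polyX map_polyC /= mxE eqxx mulr1n DE.
move=> x y; set X := map_mx _ x; set Y := map_mx _ y.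
have bilin_toC (v w : 'cV[R]_n) :
    toC (bilin A v w) = bilin AC (map_mx toC v) (map_mx toC w).
  by rewrite /bilin map_trmx -!map_mxM [RHS]mxE.
set c := X + _; pose cc := map_mx Num.conj c.
have cE : bilin AC cc c = toC (bilin A x x + bilin A y y).
  rewrite rmorphD /= !bilin_toC -/X -/Y.
  have AC_sym : AC^T = AC by rewrite /AC map_trmx Asym.
  have := bilinC Y X AC_sym; rewrite /bilin => eqYX.
  have -> : cc^T = X^T - 'i%C *: Y^T.
    apply/matrixP => i j; rewrite !mxE rmorphD rmorphM /=.
    have realC (r : R) : (toC r)^* = toC r.
      by apply/CrealP/complex_realP; exists r.
    by rewrite complexiE conjCi !realC mulNr.
  rewrite mulmxDr !mulmxBl -!scalemxAr -!scalemxAl.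
  move: (X^T *m _ *m X) (X^T *m _ *m Y) (Y^T *m _ *m X) (Y^T *m _ *m Y) eqYX.
  move=> W1 W2 W3 W4 eqW; rewrite !mxE eqW.
  rewrite !mulrA -expr2 sqr_i; ring.
rewrite -cE /bilin.
have cc_adj : cc^T *m invmx P = (map_mx Num.conj (P *m c))^T.
  rewrite invmx_unitary ?spectral_unitarymx // map_mxM trmx_mul.
  by rewrite map_trmx; congr (_ *m _); apply/matrixP => i j; rewrite !mxE.
rewrite AC_E !mulmxA cc_adj -!mulmxA mxE; apply: eq_bigr => i _.
move: (P *m c) => w; rewrite mul_diag_mx !mxE DE normCK.
by rewrite mulrC mulrA.
Qed.

Lemma nontrivial_combination (F : fieldType) (s t : F) :
  exists a b : F, a * s + b * t = 0 /\ (a != 0) || (b != 0).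
Proof.
have [->|s0] := eqVneq s 0.
  by exists 1, 0; rewrite mulr0 mul0r addr0 oner_eq0.
by exists (- t), s; rewrite mulNr mulrC addNr s0 orbT.
Qed.

Lemma eigenvalue_count (A : 'M[R]_n) (d : 'I_n -> R) :
  char_poly A = \prod_i ('X - (d i)%:P) ->
  one_negative_eigenvalue A <-> #|[pred i | d i < 0]| = 1%N.
Proof.
move=> charA; have cardE : count (fun a => a < 0) (codom d) = #|[pred i | d i < 0]|.
  by rewrite count_map cardE size_filter enumT; apply: eq_count.
have charE : char_poly A = \prod_(a <- codom d) ('X - a%:P).
  by rewrite charA big_map enumT.
split=> [[s]|card1]; last by exists (codom d); rewrite ?cardE.
by rewrite charE => /prod_XsubC_eq/permP perm_ds <-; rewrite -cardE perm_ds.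
Qed.

(** A form with one negative eigenvalue is nonnegative on the kernel of a
    suitable functional, and this kernel meets the span of two vectors. *)
Lemma one_negative_orthogonal (A : 'M[R]_n) (y1 y2 : 'cV[R]_n) :
    A^T = A -> one_negative_eigenvalue A -> bilin A y1 y2 = 0 ->
  bilin A y1 y1 < 0 -> bilin A y2 y2 < 0 -> False.
Proof.
move=> Asym A1 y12 y1neg y2neg.
have [P [d [Punit charA formA]]] := symmetric_diagonalization Asym.
have /mem_card1[i0 i0P] := (eigenvalue_count charA).1 A1.
have d_ge0 i : i != i0 -> 0 <= d i.
  by have := i0P i; rewrite !inE leNgt => -> ->.
have form_ge0 (x y : 'cV[R]_n) :
    (P *m (map_mx toC x + 'i%C *: map_mx toC y)) i0 0 = 0 ->
  0 <= bilin A x x + bilin A y y.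
  move=> Pi0; rewrite -lecR formA; apply: sumr_ge0 => i _.
  have [->|ii0] := eqVneq i i0; first by rewrite Pi0 normr0 expr0n mulr0.
  by rewrite mulr_ge0 ?exprn_ge0 // lecR d_ge0.
(* The coordinate of index i0 is complex, so the combination of y1 and y2 that
   kills it has complex coefficients; its real and imaginary parts are real
   combinations of y1 and y2. *)
pose w (z : 'cV[R]_n) := (P *m map_mx toC z) i0 0.
have [a [b [ab0 ab_neq0]]] := nontrivial_combination (w y1) (w y2).
pose comb (r s : R) := r *: y1 + s *: y2.
have q_comb r s : bilin A (comb r s) (comb r s) =
    r ^+ 2 * bilin A y1 y1 + s ^+ 2 * bilin A y2 y2.
  by rewrite bilin_comb // y12 mulr0 addr0.
have := form_ge0 (comb (complex.Re a) (complex.Re b))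
                 (comb (complex.Im a) (complex.Im b)).
have -> : map_mx toC (comb (complex.Re a) (complex.Re b)) +
    'i%C *: map_mx toC (comb (complex.Im a) (complex.Im b)) =
    a *: map_mx toC y1 + b *: map_mx toC y2.
  apply/matrixP => i j; rewrite !mxE [in RHS](complexE a) [in RHS](complexE b).
  by rewrite !rmorphD !rmorphM /=; ring.
rewrite mulmxDr -!scalemxAr mxE [X in X + _]mxE [X in _ + X]mxE => /(_ ab0).
rewrite !q_comb.
have sq_gt0 (c : C) : c != 0 -> 0 < complex.Re c ^+ 2 + complex.Im c ^+ 2.
  rewrite eq_complex negb_and /= lt_def paddr_eq0 ?sqr_ge0 //.
  by rewrite !sqrf_eq0 negb_and addr_ge0 ?sqr_ge0 // andbT.
have [ar ai br bi] : [/\ 0 <= complex.Re a ^+ 2, 0 <= complex.Im a ^+ 2,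
    0 <= complex.Re b ^+ 2 & 0 <= complex.Im b ^+ 2] by rewrite !sqr_ge0.
by case/orP: ab_neq0 => /sq_gt0 => ?; nra.
Qed.

(** Two negative eigenvalues would give a plane on which the form is negative,
    and this plane contains a nonzero vector killed by l. *)
Lemma one_negativeI (A : 'M[R]_n) (l : 'rV[R]_n) (y : 'cV[R]_n) :
    A^T = A -> bilin A y y < 0 ->
    (forall z : 'cV[R]_n, l *m z = 0 -> 0 <= bilin A z z) ->
  one_negative_eigenvalue A.
Proof.
move=> Asym y_neg l_pos.
have [P [d [Punit charA formA]]] := symmetric_diagonalization Asym.
apply/(eigenvalue_count charA); apply/eqP; rewrite eqn_leq; apply/andP; split.
  apply/card_le1_eqP => i j; rewrite !inE => di dj; apply: contraTeq isT => ji.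
  pose lC := map_mx toC l; pose v k := col k (invmx P).
  have [a [b [ab0 ab_neq0]]] :=
    nontrivial_combination ((lC *m v i) 0 0) ((lC *m v j) 0 0).
  pose c := a *: v i + b *: v j.
  pose x := map_mx (@complex.Re R) c; pose z := map_mx (@complex.Im R) c.
  have cE : map_mx toC x + 'i%C *: map_mx toC z = c.
    rewrite /x /z; move: (c) => c'.
    by apply/matrixP => k k'; rewrite !mxE -complexE.
  have lc0 : toC ((l *m x) 0 0) + 'i%C * toC ((l *m z) 0 0) = 0.
    transitivity ((lC *m c) 0 0).
      rewrite -cE mulmxDr -scalemxAr -!map_mxM.
      by move: (l *m x) (l *m z) => X Z; rewrite !mxE.
    by rewrite mulmxDr -!scalemxAr mxE [X in X + _]mxE [X in _ + X]mxE.
  have [lx lz] : l *m x = 0 /\ l *m z = 0.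
    move: lc0; move: (l *m x) (l *m z) => X Z /eqP; simpc.
    rewrite eq_complex /= => /andP[/eqP X0 /eqP Z0].
    by split; apply/matrixP => k k'; rewrite !ord1 mxE.
  have := addr_ge0 (l_pos x lx) (l_pos z lz); rewrite -lecR formA cE.
  have Pc k : (P *m c) k 0 = a * (k == i)%:R + b * (k == j)%:R.
    have Pv k' : P *m v k' = col k' 1%:M.
      by rewrite /v colE mulmxA mulmxV // mul1mx colE mul1mx.
    by rewrite mulmxDr -!scalemxAr !Pv !mxE.
  have ij : i != j by rewrite eq_sym.
  rewrite (bigD1 i) //= (bigD1 j) //= big1 ?addr0; last first.
    move=> k /andP[/negPf ki /negPf kj].
    by rewrite Pc ki kj !mulr0 addr0 normr0 expr0n mulr0.
  rewrite !Pc !eqxx (negPf ij) (negPf ji) !mulr0 !mulr1 addr0 add0r.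
  suff /lt_geF-> : toC (d i) * `|a| ^+ 2 + toC (d j) * `|b| ^+ 2 < 0 by [].
  have [dCi dCj] : toC (d i) < 0 /\ toC (d j) < 0 by rewrite !ltcR.
  case/orP: ab_neq0 => nz.
    by rewrite ltr_wnDr // ?nmulr_rlt0 ?exprn_gt0 ?normr_gt0 // nmulr_rle0 ?exprn_ge0.
  by rewrite ltr_wnDl // ?nmulr_rlt0 ?exprn_gt0 ?normr_gt0 // nmulr_rle0 ?exprn_ge0.
rewrite lt0n; apply: contraTneq y_neg => /card0_eq d_ge0; rewrite -leNgt.
suff: 0 <= bilin A y y + bilin A 0 0 by rewrite [X in _ + X]/bilin mulmx0 mxE addr0.
rewrite -lecR formA; apply: sumr_ge0 => i _.
by rewrite mulr_ge0 ?exprn_ge0 // lecR leNgt; have := d_ge0 i; rewrite !inE => ->.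
Qed.
End Spectral.

(** * Separators *)

Definition avoiding (T : eqType) (e : rel T) (c : T) : rel T :=
  [rel i j | [&& e i j, i != c & j != c]].

Lemma connect_invariant (T : finType) (e : rel T) (P : pred T) (x y : T) :
  (forall v w, P v -> e v w -> P w) -> P x -> connect e x y -> P y.
Proof.
move=> Pe Px /connectP[s es ->] {y}.
by elim: s x Px es => //= w s IHs x Px /andP[xw]; apply: IHs (Pe _ _ Px xw).
Qed.

Lemma avoiding_sym (T : finType) (e : rel T) (c : T) :
  symmetric e -> connect_sym (avoiding e c).
Proof.
move=> e_sym; apply: sym_connect_sym => i j.
by rewrite /avoiding /= e_sym [(i != c) && _]andbC.
Qed.

Lemma connect_avoiding_neq (T : finType) (e : rel T) (c x y : T) :
  x != c -> connect (avoiding e c) x y -> y != c.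
Proof.
move=> xc; apply: (@connect_invariant _ _ [pred z | z != c]) => // v w _.
by case/and3P.
Qed.

Lemma connect_avoiding1 (T : finType) (e : rel T) (c x y : T) :
  e x y -> x != c -> y != c -> connect (avoiding e c) x y.
Proof. by move=> xy xc yc; apply: connect1; apply/and3P. Qed.

(** Among three distinct nodes, one separates the other two.  The connected
    graphs with this property are the paths. *)
Definition linear_triples (T : finType) (e : rel T) : Prop :=
  forall a b c : T, a != b -> a != c -> b != c ->
  ~~ [&& connect (avoiding e c) a b, connect (avoiding e b) a c &
         connect (avoiding e a) b c].

(** A path from c to a can be stopped when it first meets b, and then it has not
    met a.  The proof replaces the first visit by an invariant: if b were never
    reached from c in G - a, then no walk from c could leave the nodes that c
    reaches avoiding both a and b. *)
Lemma separator_side (T : finType) (e : rel T) (a b c : T) :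
    symmetric e -> connected_graph e -> a != b -> a != c -> b != c ->
    ~~ connect (avoiding e b) a c ->
  connect (avoiding e a) b c.
Proof.
move=> e_sym e_conn ab ac bc sep; rewrite avoiding_sym //.
apply: contraT => cb.
pose P v := [&& v != a, v != b, connect (avoiding e a) c v &
                connect (avoiding e b) c v].
have : P a.
  apply: (@connect_invariant _ e P c) (e_conn c a); last first.
    by rewrite /P ![c == _]eq_sym ac bc !connect0.
  move=> v w /and4P[va vb cva cvb] vw.
  have [wb|wb] := eqVneq w b.
    case/negP: cb; rewrite -wb; apply: connect_trans cva _.
    by apply: connect_avoiding1; rewrite // wb eq_sym.
  have cwb : connect (avoiding e b) c w.
    exact: connect_trans cvb (connect_avoiding1 vw vb wb).
  have wa : w != a by apply: contraNneq sep => wa; rewrite avoiding_sym // -wa.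
  by rewrite /P wa wb cwb (connect_trans cva (connect_avoiding1 vw va wa)).
by rewrite /P eqxx.
Qed.

Definition signed_on (R : numDomainType) n (e : rel 'I_n) (M : 'M[R]_n) : Prop :=
  [/\ M^T = M,
      forall i j, i != j -> ~~ e i j -> M i j = 0 &
      forall i j, i != j -> e i j -> M i j < 0].

Lemma sum_lt0 (R : numDomainType) (I : finType) (F : I -> R) (i0 : I) :
  (forall i, F i <= 0) -> F i0 < 0 -> \sum_i F i < 0.
Proof. by move=> F_le0 Fi0; rewrite (bigD1 i0) //= ltr_wnDr // sumr_le0. Qed.

Section Nodal.
Variables (R : realType) (n : nat) (e : rel 'I_n).
Hypotheses (e_sym : symmetric e) (e_irr : irreflexive e).
Variables (M : 'M[R]_n) (u p : 'cV[R]_n) (lam : R).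
Hypotheses (M_signed : signed_on e M) (M_neg : one_negative_eigenvalue M).
Hypotheses (u_ker : M *m u = 0) (p_gt0 : forall i, 0 < p i 0).
Hypotheses (lam_lt0 : lam < 0) (p_eigen : M *m p = lam *: p).

(** As lam < 0 < p, every entry of M (u - t p) has the sign of t. *)
Lemma mul_sub_eigen (t : R) i : (M *m (u - t *: p)) i 0 = - (t * lam * p i 0).
Proof. by rewrite mulmxBr -scalemxAr u_ker p_eigen scalerA sub0r !mxE. Qed.

Section Truncation.
Variables (b : 'I_n) (z : 'cV[R]_n).
Hypotheses (z_b : z b 0 = 0) (Mz_lt0 : forall i, (M *m z) i 0 < 0).

(** The positive part of z on the component of t in G - b. *)
Definition truncation t : 'cV[R]_n :=
  \col_i (if connect (avoiding e b) t i then Num.max 0 (z i 0) else 0).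

(** On the support of the truncation y, passing from z to y does not decrease
    the entries at neighbours, whose coefficients in M are negative; hence
    M y <= M z < 0 there.  The support is not empty: if z vanishes at t, then the
    t-th entry of M z can only be negative because z is positive at some
    neighbour of t. *)
Lemma truncation_neg t : t != b -> 0 <= z t 0 ->
  bilin M (truncation t) (truncation t) < 0.
Proof.
have [M_sym M_nonadj M_adj] := M_signed.
move=> tb zt; set y := truncation t.
have y_ge0 i : 0 <= y i 0 by rewrite mxE; case: ifP; rewrite // le_max lexx.
have compP i : 0 < y i 0 -> connect (avoiding e b) t i /\ y i 0 = z i 0.
  rewrite mxE; case: ifP => [|_]; rewrite ?ltxx // => ti.
  by rewrite lt_max ltxx /= => zi; split=> //; rewrite max_r // ltW.
have My_lt0 i : 0 < y i 0 -> (M *m y) i 0 < 0.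
  move=> yi; apply: le_lt_trans (Mz_lt0 i); have [ti yz] := compP _ yi.
  have ib := connect_avoiding_neq tb ti.
  rewrite !mxE; apply: ler_sum => j _.
  have [<-|ij] := eqVneq i j; first by rewrite yz.
  have [eij|eij] := boolP (e i j); last by rewrite M_nonadj // !mul0r.
  rewrite ler_nM2l ?M_adj //.
  have [->|jb] := eqVneq j b; first by rewrite z_b.
  by rewrite mxE (connect_trans ti (connect_avoiding1 eij ib jb)) le_max lexx orbT.
have [i0 yi0] : exists i0, 0 < y i0 0.
  have [zt0|zt0] := eqVneq (z t 0) 0; last first.
    by exists t; rewrite mxE connect0 lt_max ltxx /= lt_def zt0.
  have [j Mj] : exists j, M t j * z j 0 < 0.
    apply/existsP; apply: contraLR (Mz_lt0 t); rewrite negb_exists => /forallP Mz.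
    by rewrite -leNgt mxE sumr_ge0 // => j _; rewrite leNgt.
  have tj : t != j by apply: contraTneq Mj => <-; rewrite zt0 mulr0 ltxx.
  have etj : e t j by apply: contraTT Mj => etj; rewrite M_nonadj // mul0r ltxx.
  have zj : 0 < z j 0 by move: Mj; rewrite nmulr_rlt0 // M_adj.
  have jb : j != b by apply: contraTneq zj => ->; rewrite z_b ltxx.
  by exists j; rewrite mxE (connect_avoiding1 etj tb jb) lt_max zj orbT.
rewrite bilinE; apply: (@sum_lt0 _ _ _ i0) => [i|]; last first.
  by rewrite pmulr_rlt0 // My_lt0.
have := y_ge0 i; rewrite le_eqVlt => /predU1P[<-|yi]; first by rewrite mul0r.
by rewrite pmulr_rle0 // ltW // My_lt0.
Qed.

(** Two distinct components of G - b are disjoint and not adjacent. *)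
Lemma truncation_orthogonal a c : a != b -> c != b ->
  ~~ connect (avoiding e b) a c -> bilin M (truncation a) (truncation c) = 0.
Proof.
have [M_sym M_nonadj M_adj] := M_signed.
move=> ab cb sep; rewrite bilinE big1 // => i _; rewrite !mxE.
case: ifP => [ai|]; rewrite ?mul0r // big1 ?mulr0 // => j _; rewrite mxE.
case: ifP => [cj|]; rewrite ?mulr0 // M_nonadj ?mul0r //.
  apply: contraNneq sep => ij; apply: connect_trans ai _.
  by rewrite avoiding_sym // ij.
apply: contraNN sep => eij; apply: (connect_trans ai).
apply: connect_trans (connect_avoiding1 eij _ _) _.
- exact: connect_avoiding_neq ai.
- exact: connect_avoiding_neq cj.
- by rewrite avoiding_sym.
Qed.
End Truncation.

Let x i := u i 0 / p i 0.

Let x_le (t : R) i : (t <= x i) = (0 <= (u - t *: p) i 0).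
Proof. by rewrite /x ler_pdivlMr // !mxE subr_ge0. Qed.

Lemma separator_nonneg a b c : a != b -> c != b ->
  ~~ connect (avoiding e b) a c -> x b <= x a -> x b <= x c -> 0 <= x b.
Proof.
move=> ab cb sep; rewrite !(x_le (x b)) => za zc; rewrite leNgt; apply/negP => xb.
have [M_sym _ _] := M_signed; set z := u - x b *: p in za zc.
have zb : z b 0 = 0 by rewrite !mxE /x divfK ?subrr // gt_eqF.
have Mz i : (M *m z) i 0 < 0.
  by rewrite mul_sub_eigen oppr_lt0 mulr_gt0 // nmulr_rgt0.
apply: (one_negative_orthogonal M_sym M_neg (truncation_orthogonal z ab cb sep)).
  exact: (truncation_neg zb Mz ab za).
exact: (truncation_neg zb Mz cb zc).
Qed.

Hypotheses (e_conn : connected_graph e) (e_lin : linear_triples e).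

(** Any two of three neighbours of v are joined through v, so that none of the
    three separates the other two. *)
Lemma linear_triples_degree v a c d :
  e v a -> e v c -> e v d -> a != c -> a != d -> c != d -> False.
Proof.
move=> va vc vd ac ad cd.
have step s t w : e v s -> e v t -> e v w -> s != w -> t != w ->
    connect (avoiding e w) s t.
  move=> vs vt vw sw tw; have vNw : v != w by apply: contraTneq vw => ->; rewrite e_irr.
  apply: (@connect_trans _ _ v); last exact: connect_avoiding1.
  by apply: connect_avoiding1; rewrite // e_sym.
case/negP: (e_lin ac ad cd).
by rewrite (step a c d) ?(step a d c) ?(step c d a) // 1?eq_sym // [d == a]eq_sym.
Qed.

(** Let u vanish at s and at its neighbour w.  By the degree bound, w has at
    most one further neighbour j, so the w-th row of M u = 0 leaves only
    M_wj u_j = 0. *)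
Lemma zero_neighborhood v :
  u v 0 = 0 -> (forall w, e v w -> u w 0 = 0) -> u = 0.
Proof.
have [M_sym M_nonadj M_adj] := M_signed.
move=> uv uNv; pose P v := (u v 0 == 0) && [forall w, e v w ==> (u w 0 == 0)].
have Pv : P v.
  by rewrite /P uv eqxx; apply/forallP => w; apply/implyP => /uNv ->.
have P_closed s w : P s -> e s w -> P w.
  case/andP=> us /forallP uNs sw; have uw := implyP (uNs w) sw.
  rewrite /P uw; apply/forallP => j; apply/implyP => wj; apply: contraT => uj.
  have : (M *m u) w 0 = 0 by rewrite u_ker mxE.
  rewrite mxE (bigD1 j) //= big1 ?addr0 => [/eqP|k kj].
    rewrite mulf_eq0 (negPf uj) orbF lt_eqF ?M_adj //.
    by apply: contraTneq wj => ->; rewrite e_irr.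
  have [<-|wk] := eqVneq w k; first by rewrite (eqP uw) mulr0.
  have [ewk|ewk] := boolP (e w k); last by rewrite M_nonadj // mul0r.
  have [->|ks] := eqVneq k s; first by rewrite (eqP us) mulr0.
  have js : j != s by apply: contraNneq uj => ->.
  have ews : e w s by rewrite e_sym.
  by case: (linear_triples_degree ewk wj ews kj ks js).
apply/matrixP => i j; rewrite ord1 mxE.
by have /andP[/eqP] := connect_invariant P_closed Pv (e_conn v i).
Qed.

(** The extremal argument: a separator of a and c with least x would be a local
    minimum of x with a nonnegative value, which only u = 0 allows. *)
Lemma separator_not_low a b c : u != 0 -> a != b -> a != c -> b != c ->
  ~~ connect (avoiding e b) a c -> ~~ ((x b <= x a) && (x b <= x c)).
Proof.
have [M_sym M_nonadj M_adj] := M_signed.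
move=> u_neq0 ab ac bc sep; apply/negP => /andP[xa xc].
pose sepP k := [&& k != a, k != c & ~~ connect (avoiding e k) a c].
have sep_b : sepP b by rewrite /sepP eq_sym ab bc.
have [k /and3P[ka kc ksep] kmin] := arg_minP x sep_b.
have xk_ge0 : 0 <= x k.
  apply: (separator_nonneg _ _ ksep); rewrite 1?eq_sym //.
    exact: le_trans (kmin b sep_b) xa.
  exact: le_trans (kmin b sep_b) xc.
(* A neighbour w of k is joined to c avoiding a and to a avoiding c, both times
   through k; so in the triple a, c, w only w can be the separator. *)
have nbr_sep w : e k w -> x k <= x w.
  move=> kw; have wk : w != k by apply: contraTneq kw => ->; rewrite e_irr.
  have [->|wa] := eqVneq w a; first exact: le_trans (kmin b sep_b) xa.
  have [->|wc] := eqVneq w c; first exact: le_trans (kmin b sep_b) xc.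
  apply: kmin; rewrite /sepP wa wc /=.
  have ck : connect (avoiding e a) c w.
    apply: connect_trans (connect_avoiding1 kw ka wa); rewrite avoiding_sym //.
    by apply: separator_side ksep; rewrite // eq_sym.
  have ak : connect (avoiding e c) a w.
    apply: connect_trans (connect_avoiding1 kw kc wc); rewrite avoiding_sym //.
    by apply: separator_side; rewrite // 1?avoiding_sym // eq_sym // eq_sym.
  have aw : a != w by rewrite eq_sym.
  have cw : c != w by rewrite eq_sym.
  by have := e_lin ac aw cw; rewrite ak ck !andbT.
set z := u - x k *: p.
have zk : z k 0 = 0 by rewrite !mxE /x divfK ?subrr // gt_eqF.
have terms_le0 j : M k j * z j 0 <= 0.
  have [<-|kj] := eqVneq k j; first by rewrite zk mulr0.
  have [ekj|ekj] := boolP (e k j); last by rewrite M_nonadj // mul0r.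
  by rewrite nmulr_rle0 ?M_adj // -x_le nbr_sep.
have Mz_ge0 : 0 <= (M *m z) k 0.
  by rewrite mul_sub_eigen oppr_ge0 pmulr_lle0 // mulr_ge0_le0 // ltW.
have Mz0 : (M *m z) k 0 = 0.
  by apply/le_anti; rewrite Mz_ge0 andbT mxE sumr_le0.
have xk0 : x k = 0.
  move: Mz0; rewrite mul_sub_eigen => /eqP.
  rewrite oppr_eq0 mulf_eq0 (gt_eqF (p_gt0 k)) orbF mulf_eq0 (lt_eqF lam_lt0) orbF.
  by move/eqP.
have zE : z = u by rewrite /z xk0 scale0r subr0.
case/eqP: u_neq0; apply: (@zero_neighborhood k); rewrite -zE // => w kw.
have kNw : k != w by apply: contraTneq kw => ->; rewrite e_irr.
have : - (M *m z) k 0 = 0 by rewrite Mz0 oppr0.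
rewrite mxE -sumrN => /eqP; rewrite psumr_eq0 => [|j _]; last by rewrite oppr_ge0.
move/allP/(_ w); rewrite mem_index_enum => /(_ isT) /=.
by rewrite oppr_eq0 mulf_eq0 lt_eqF ?M_adj //= => /eqP.
Qed.
End Nodal.

(** * A matrix of corank two from a triple of mutually unseparated nodes *)

Section CorankTwo.
Variables (R : realType) (n : nat) (e : rel 'I_n).
Hypothesis e_sym : symmetric e.

(** The Laplacian plus the identity: a positive definite well-signed matrix. *)
Definition shifted_laplacian : 'M[R]_n :=
  \matrix_(i, j) ((1 + \sum_k (e i k)%:R) *+ (i == j) - (e i j)%:R).
Local Notation L := shifted_laplacian.

Lemma laplacianE (y : 'cV[R]_n) i :
  (L *m y) i 0 = y i 0 + \sum_j (e i j)%:R * (y i 0 - y j 0).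
Proof.
rewrite mxE; under eq_bigr do rewrite mxE mulrBl.
under [in RHS]eq_bigr do rewrite mulrBr.
rewrite !sumrB -mulr_suml addrA -[X in _ = X + _ - _]mul1r -mulrDl.
move: (1 + _) => d; rewrite (bigD1 i) //= eqxx mulr1n big1 ?addr0 // => j.
by rewrite eq_sym => /negPf->; rewrite mulr0n mul0r.
Qed.

Lemma laplacian_sym : L^T = L.
Proof.
apply/matrixP => i j; rewrite !mxE e_sym eq_sym.
by case: eqVneq => [->|].
Qed.

Lemma laplacian_psd (y : 'cV[R]_n) : 0 <= bilin L y y.
Proof.
rewrite bilinE; under eq_bigr do rewrite laplacianE mulrDr mulr_sumr.
rewrite big_split /= addr_ge0 //.
  by apply: sumr_ge0 => i _; rewrite -expr2 sqr_ge0.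
set S := \sum_i _.
have SE : S = \sum_i \sum_j y j 0 * ((e i j)%:R * (y j 0 - y i 0)).
  rewrite /S exchange_big; apply: eq_bigr => i _; apply: eq_bigr => j _.
  by rewrite e_sym.
suff: 0 <= S + S by rewrite -mulr2n pmulrn_lge0.
rewrite {1}SE -big_split /=; apply: sumr_ge0 => i _.
rewrite -big_split /=; apply: sumr_ge0 => j _.
have -> : y j 0 * ((e i j)%:R * (y j 0 - y i 0)) +
    y i 0 * ((e i j)%:R * (y i 0 - y j 0)) = (e i j)%:R * (y i 0 - y j 0) ^+ 2.
  by ring.
by rewrite mulr_ge0 ?sqr_ge0.
Qed.

Section Harmonic.
Variable T : {set 'I_n}.

(** The operator of the Dirichlet problem with boundary T: the identity on T and
    L elsewhere. *)
Definition dirichlet_mx : 'M[R]_n :=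
  \matrix_(i, j) (if i \in T then (i == j)%:R else L i j).
Local Notation B := dirichlet_mx.

Lemma dirichletE (y : 'cV[R]_n) i :
  (B *m y) i 0 = if i \in T then y i 0 else (L *m y) i 0.
Proof.
rewrite !mxE; case: ifP => iT.
  rewrite (bigD1 i) //= mxE iT eqxx mul1r big1 ?addr0 // => j.
  by rewrite mxE iT eq_sym => /negPf->; rewrite mul0r.
by apply: eq_bigr => j _; rewrite mxE iT.
Qed.

(** At a node outside T where y is least, L y is at most y. *)
Lemma minimum_principle (y : 'cV[R]_n) i :
  (forall k, 0 <= (B *m y) k 0) -> 0 <= y i 0.
Proof.
move=> By_ge0.
have [k _ kmin] := @arg_minP _ _ _ i xpredT (fun k => y k 0) isT.
apply: le_trans (kmin i isT); have := By_ge0 k; rewrite dirichletE.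
case: ifP => // _; rewrite laplacianE => yk; apply: le_trans yk _.
rewrite gerDl sumr_le0 // => j _.
by rewrite mulr_ge0_le0 // subr_le0 kmin.
Qed.

Lemma dirichlet_unit : B \in unitmx.
Proof.
rewrite -unitmx_tr -row_free_unit; apply: inj_row_free => v vB0.
have B0 : B *m v^T = 0 by rewrite -[B]trmxK -trmx_mul vB0 trmx0.
apply/matrixP => i j; rewrite ord1 mxE; apply/le_anti/andP; split.
  have := @minimum_principle (- v^T) j; rewrite !mxE oppr_ge0; apply => k.
  by rewrite mulmxN B0 !mxE oppr0.
by have := @minimum_principle v^T j; rewrite mxE; apply => k; rewrite B0 mxE.
Qed.

(** The L-harmonic extension to all nodes of the indicator of t on T. *)
Definition harmonic (t : 'I_n) : 'cV[R]_n := invmx B *m delta_mx t 0.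

Lemma harmonicE t i :
  (if i \in T then harmonic t i 0 else (L *m harmonic t) i 0) = (i == t)%:R.
Proof.
by rewrite -dirichletE /harmonic mulmxA mulmxV ?dirichlet_unit // mul1mx mxE andbT.
Qed.

Lemma harmonic_boundary t i : i \in T -> harmonic t i 0 = (i == t)%:R.
Proof. by move=> iT; have := harmonicE t i; rewrite iT. Qed.

Lemma harmonic_interior t i : t \in T -> i \notin T -> (L *m harmonic t) i 0 = 0.
Proof.
move=> tT iT; have := harmonicE t i; rewrite (negPf iT) => ->.
by case: eqP iT => // ->; rewrite tT.
Qed.

Lemma harmonic_ge0 t i : 0 <= harmonic t i 0.
Proof.
apply: minimum_principle => k.
by rewrite /harmonic mulmxA mulmxV ?dirichlet_unit // mul1mx mxE.
Qed.

(** For s and t in T, the (s, t) entry of the Schur complement of L on T. *)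
Definition response s t : R := (L *m harmonic t) s 0.

(** The extension of the indicator of s vanishes on the rest of T, while L sends
    the other extension to zero outside T. *)
Lemma bilin_harmonic s t : s \in T -> t \in T ->
  bilin L (harmonic s) (harmonic t) = response s t.
Proof.
move=> sT tT; rewrite bilinE (bigD1 s) //= harmonic_boundary // eqxx mul1r.
rewrite big1 ?addr0 // => i i_s; have [iT|iT] := boolP (i \in T).
  by rewrite harmonic_boundary // (negPf i_s) mul0r.
by rewrite harmonic_interior // mulr0.
Qed.

Lemma response_sym s t : s \in T -> t \in T -> response s t = response t s.
Proof. by move=> sT tT; rewrite -!bilin_harmonic // bilinC // laplacian_sym. Qed.

Lemma harmonic_neighbor t w v : t \in T -> w \notin T -> e w v ->
  0 < harmonic t v 0 -> 0 < harmonic t w 0.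
Proof.
move=> tT wT wv hv; rewrite lt_def harmonic_ge0 andbT.
apply/eqP => hw; have := harmonic_interior tT wT.
rewrite laplacianE hw add0r; apply/eqP; rewrite lt_eqF //.
apply: (@sum_lt0 _ _ _ v) => [j|].
  by rewrite sub0r mulr_ge0_le0 // oppr_le0 harmonic_ge0.
by rewrite wv mul1r sub0r oppr_lt0.
Qed.

(** The entry is minus the sum of the values of the extension at the neighbours
    of s.  If all of these were zero, then positivity, which spreads from
    t along the edges of G - c, would have to reach s through a neighbour of s at
    which the extension is zero. *)
Lemma response_lt0 s t c : s \in T -> t \in T -> s != t -> t != c ->
    {in T, forall k, k != s -> k != t -> k = c} ->
    connect (avoiding e c) t s -> response s t < 0.
Proof.
move=> sT tT st tc Tc conn.
have hs : harmonic t s 0 = 0 by rewrite harmonic_boundary // (negPf st).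
pose F j : R := (e s j)%:R * (0 - harmonic t j 0).
have responseE : response s t = \sum_j F j by rewrite /response laplacianE hs add0r.
have F_le0 j : F j <= 0.
  by rewrite /F mulr_ge0_le0 // sub0r oppr_le0 harmonic_ge0.
rewrite responseE; have [/existsP[j Fj]|noF] := boolP [exists j, F j < 0].
  exact: sum_lt0 Fj.
suff : 0 < harmonic t s 0 by rewrite hs ltxx.
pose P : pred 'I_n := [pred v | 0 < harmonic t v 0].
apply: (@connect_invariant _ _ P t s) conn; last first.
  by rewrite /P /= harmonic_boundary // eqxx ltr01.
move=> v w /= hv /and3P[vw _ wc]; have wv : e w v by rewrite e_sym.
have [wT|wT] := boolP (w \in T); last exact: harmonic_neighbor hv.
have [ws|ws] := eqVneq w s.
  case/existsP: noF; exists v.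
  by rewrite /F -ws wv mul1r sub0r oppr_lt0.
have [->|wt] := eqVneq w t; first by rewrite /P /= harmonic_boundary // eqxx ltr01.
by rewrite (Tc w wT ws wt) eqxx in wc.
Qed.

End Harmonic.

(** A positive symmetric 3 x 3 matrix whose diagonal may be chosen freely can be
    given rank one. *)
Lemma rank_one_factors (r s t : R) : 0 < r -> 0 < s -> 0 < t ->
  exists x y z : R,
  [/\ [/\ 0 < x, 0 < y & 0 < z], x * y = r, x * z = s & y * z = t].
Proof.
move=> r0 s0 t0; pose x := Num.sqrt (r * s / t).
have rst : 0 < r * s / t by rewrite !mulr_gt0 // invr_gt0.
have x0 : 0 < x by rewrite sqrtr_gt0.
exists x, (r / x), (s / x); rewrite !divr_gt0 //; split=> //; try by field; rewrite gt_eqF.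
have -> : r / x * (s / x) = r * s / x ^+ 2 by field; rewrite gt_eqF.
by rewrite sqr_sqrtr ?ltW //; field; rewrite !gt_eqF.
Qed.

(** With D correcting the diagonal of L on T = {a, b, c}, the matrix N = L - D
    maps the extension h_t to - v_t v.  Subtracting from z its L-harmonic
    interpolation of the boundary values gives g vanishing on T, and the form of
    N at z is that of L at g, hence nonnegative, whenever v^T z = 0; this leaves
    at most one negative eigenvalue, and the form is negative at h_a.  The
    combinations v_b h_a - v_a h_b and v_c h_a - v_a h_c lie in the kernel. *)
Lemma corank_two (a b c : 'I_n) : a != b -> a != c -> b != c ->
    connect (avoiding e c) a b -> connect (avoiding e b) a c ->
    connect (avoiding e a) b c ->
  exists N : 'M[R]_n,
    [/\ signed_on e N, one_negative_eigenvalue N & (1 < corank N)%N].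
Proof.
move=> ab ac bc conn_ab conn_ac conn_bc.
have [ba [ca cb]] : b != a /\ c != a /\ c != b by split; [|split]; rewrite eq_sym.
pose T := [set a; b; c]; pose h := harmonic T; pose w := response T.
have [aT bT cT] : [/\ a \in T, b \in T & c \in T] by rewrite !inE !eqxx !orbT.
have wC := response_sym.
have wab : 0 < - w a b.
  rewrite oppr_gt0; apply: (@response_lt0 _ _ _ c) => //.
    by move=> k; rewrite !inE => /orP[/orP[]|]/eqP-> //; rewrite eqxx.
  by rewrite avoiding_sym.
have wac : 0 < - w a c.
  rewrite oppr_gt0; apply: (@response_lt0 _ _ _ b) => //.
    by move=> k; rewrite !inE => /orP[/orP[]|]/eqP-> //; rewrite eqxx.
  by rewrite avoiding_sym.
have wbc : 0 < - w b c.
  rewrite oppr_gt0; apply: (@response_lt0 _ _ _ a) => //.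
    by move=> k; rewrite !inE => /orP[/orP[]|]/eqP-> //; rewrite eqxx.
  by rewrite avoiding_sym.
have [va [vb [vc [[va0 vb0 vc0] eab eac ebc]]]] := rank_one_factors wab wac wbc.
pose v : 'cV[R]_n := \col_i (if i == a then va else if i == b then vb
                              else if i == c then vc else 0).
have v_a : v a 0 = va by rewrite mxE eqxx.
have v_b : v b 0 = vb by rewrite mxE (negPf ba) eqxx.
have v_c : v c 0 = vc by rewrite mxE (negPf ca) (negPf cb) eqxx.
have vT i : i \notin T -> v i 0 = 0.
  by rewrite !inE !negb_or mxE => /andP[/andP[/negPf-> /negPf->] /negPf->].
pose D : 'rV[R]_n := \row_i (if i \in T then w i i + v i 0 ^+ 2 else 0).
pose N := L - diag_mx D.
have N_mul y i : (N *m y) i 0 = (L *m y) i 0 - D 0 i * y i 0.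
  by rewrite /N mulmxBl mul_diag_mx !mxE.
have N_sym : N^T = N by rewrite /N linearB /= laplacian_sym tr_diag_mx.
have w_v s t : s \in T -> t \in T -> s != t -> w s t = - (v s 0 * v t 0).
  have wvba : w b a = - (vb * va) by rewrite /w wC // mulrC eab opprK.
  have wvca : w c a = - (vc * va) by rewrite /w wC // mulrC eac opprK.
  have wvcb : w c b = - (vc * vb) by rewrite /w wC // mulrC ebc opprK.
  rewrite !inE => /orP[/orP[]|]/eqP-> /orP[/orP[]|]/eqP->; rewrite ?eqxx // => _;
  by rewrite ?v_a ?v_b ?v_c // ?eab ?eac ?ebc ?opprK.
have hT t i : i \in T -> h t i 0 = (i == t)%:R by exact: harmonic_boundary.
have hI t i : t \in T -> i \notin T -> (L *m h t) i 0 = 0.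
  exact: harmonic_interior.
have Nh t : t \in T -> N *m h t = - v t 0 *: v.
  move=> tT; apply/matrixP => i j; rewrite ord1 {j} N_mul [RHS]mxE.
  have [iT|iT] := boolP (i \in T); last first.
    by rewrite (vT i) // hI // mxE (negPf iT) mul0r subrr mulr0.
  rewrite hT // [D 0 i]mxE iT -[(L *m h t) i 0]/(w i t).
  have [->|it] := eqVneq i t; first by rewrite mulr1; ring.
  by rewrite mulr0 subr0 w_v // mulNr mulrC.
exists N; split.
- split=> // i j ij; rewrite !mxE (negPf ij) !mulr0n sub0r subr0 => eij.
    by rewrite (negPf eij) oppr0.
  by rewrite eij oppr_lt0 ltr01.
- apply: (@one_negativeI _ _ _ v^T (h a)) => // [|z vz].
    rewrite bilinE Nh // (bigD1 a) //= hT // eqxx mul1r big1 => [|i ia].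
      by rewrite mxE v_a addr0 mulNr oppr_lt0 mulr_gt0.
    rewrite [(_ *: v) i 0]mxE.
    have [iT|iT] := boolP (i \in T); last by rewrite (vT i) // !mulr0.
    by rewrite hT // (negPf ia) mul0r.
  (* H interpolates z on T. *)
  pose H := \sum_(t in T) z t 0 *: h t; pose g := z - H.
  have NH : N *m H = 0.
    rewrite mulmx_sumr; under eq_bigr => t tT do
      rewrite -scalemxAr Nh // scalerA mulrN scaleNr.
    rewrite sumrN -scaler_suml; suff -> : \sum_(t in T) z t 0 * v t 0 = 0.
      by rewrite scale0r oppr0.
    have : (v^T *m z) 0 0 = 0 by rewrite vz mxE.
    rewrite mxE => vz0; rewrite -[RHS]vz0 [LHS]big_mkcond; apply: eq_bigr => i _.
    by rewrite [v^T _ _]mxE mulrC; case: ifPn => // /vT->; rewrite mul0r.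
  have Ng : N *m g = N *m z by rewrite mulmxBr NH subr0.
  have -> : bilin N z z = bilin N g g.
    transitivity (bilin N z g); first by rewrite !bilinE Ng.
    by rewrite bilinC // !bilinE Ng.
  suff -> : bilin N g g = bilin L g g by exact: laplacian_psd.
  rewrite !bilinE; apply: eq_bigr => i _; rewrite N_mul.
  have [iT|iT] := boolP (i \in T); last by rewrite [D 0 i]mxE (negPf iT) mul0r subr0.
  suff -> : g i 0 = 0 by rewrite !mul0r.
  rewrite /g mxE [X in _ + X]mxE summxE (bigD1 i) //= mxE hT // eqxx mulr1.
  rewrite big1 ?addr0 ?subrr // => t /andP[_ ti].
  by rewrite mxE hT // eq_sym (negPf ti) mulr0.
pose k1 := vb *: h a - va *: h b; pose k2 := vc *: h a - va *: h c.
have combE r s (x y : 'cV[R]_n) i :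
    (r *: x - s *: y) i 0 = r * x i 0 - s * y i 0 by rewrite !mxE.
have kerN k : N *m k = 0 -> k^T *m N^T = 0.
  by move=> Nk; rewrite -trmx_mul Nk trmx0.
have Nk1 : N *m k1 = 0.
  rewrite mulmxBr -!scalemxAr !Nh // v_a v_b !scalerA -scalerBl.
  by rewrite !mulrN opprK mulrC addNr scale0r.
have Nk2 : N *m k2 = 0.
  rewrite mulmxBr -!scalemxAr !Nh // v_a v_c !scalerA -scalerBl.
  by rewrite !mulrN opprK mulrC addNr scale0r.
pose K := col_mx k1^T k2^T.
have K_ker : (K <= kermx N^T)%MS.
  by apply/sub_kermxP; rewrite mul_col_mx !kerN // col_mx0.
apply: leq_trans (mxrankS K_ker); suff /eqP-> : row_free K by [].
apply: inj_row_free => r; rewrite -[r]hsubmxK mul_row_col.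
move: (lsubmx r) (rsubmx r) => r1 r2 rK.
have rowE (x y : 'cV[R]_n) i :
    (r1 *m x^T + r2 *m y^T) 0 i = r1 0 0 * x i 0 + r2 0 0 * y i 0.
  by rewrite !mxE !big_ord1 !mxE.
have rKi i : r1 0 0 * k1 i 0 + r2 0 0 * k2 i 0 = 0 by rewrite -rowE rK mxE.
have [r10 r20] : r1 0 0 = 0 /\ r2 0 0 = 0.
  split.
    have := rKi b; rewrite !combE !hT // eqxx (negPf ba) (negPf bc).
    rewrite !mulr0 !subr0 mulr0 addr0 mulr1 sub0r => /eqP.
    by rewrite mulf_eq0 oppr_eq0 (gt_eqF va0) orbF => /eqP.
  have := rKi c; rewrite !combE !hT // eqxx (negPf ca) (negPf cb).
  rewrite !mulr0 !subr0 mulr0 add0r mulr1 sub0r => /eqP.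
  by rewrite mulf_eq0 oppr_eq0 (gt_eqF va0) orbF => /eqP.
apply/matrixP => i j; rewrite ord1 !mxE; case: splitP => k _.
  by rewrite ord1 r10.
by rewrite ord1 r20.
Qed.
End CorankTwo.

(** * The nullspace map sends the graph to the line *)

Section Line.
Variables (R : realType) (n : nat) (e : rel 'I_n).
Hypotheses (e_sym : symmetric e) (e_irr : irreflexive e).
Hypotheses (e_conn : connected_graph e) (e_lin : linear_triples e).
Variables (M : 'M[R]_n) (u p : 'cV[R]_n) (lam : R).
Hypotheses (M_signed : signed_on e M) (M_neg : one_negative_eigenvalue M).
Hypotheses (u_neq0 : u != 0) (u_ker : M *m u = 0).
Hypotheses (p_gt0 : forall i, 0 < p i 0).
Hypotheses (lam_lt0 : lam < 0) (p_eigen : M *m p = lam *: p).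

Let x i := u i 0 / p i 0.

Lemma separator_between a b c : a != b -> a != c -> b != c ->
  ~~ connect (avoiding e b) a c -> x a < x b < x c \/ x c < x b < x a.
Proof.
move=> ab ac bc sep.
have := separator_not_low e_sym e_irr M_signed M_neg u_ker p_gt0 lam_lt0 p_eigen
  e_conn e_lin u_neq0 ab ac bc sep.
have Nu_neq0 : - u != 0 by rewrite oppr_eq0.
have Nu_ker : M *m - u = 0 by rewrite mulmxN u_ker oppr0.
have := separator_not_low e_sym e_irr M_signed M_neg Nu_ker p_gt0 lam_lt0 p_eigen
  e_conn e_lin Nu_neq0 ab ac bc sep.
have NxE k : (- u) k 0 / p k 0 = - x k by rewrite mxE mulNr.
rewrite !NxE !lerN2 -!/(x _).
by case: (ltgtP (x a) (x b)); case: (ltgtP (x b) (x c)) => //; auto.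
Qed.

(** The third node cannot separate the ends of the edge, so one end separates the
    third node from the other end, and lies between their images. *)
Lemma edge_free i j k : e i j -> k != i -> k != j ->
  ~ in_segment (x i) (x j) (x k).
Proof.
move=> eij ki kj.
have ij : i != j by apply: contraTneq eij => ->; rewrite e_irr.
have [ik jk] : i != k /\ j != k by split; rewrite eq_sym.
have ji : j != i by rewrite eq_sym.
have := e_lin ij ik jk; rewrite (connect_avoiding1 eij ik jk) /= negb_and.
rewrite /in_segment => /orP[] /separator_between.
  by move=> /(_ ij ik jk); case: (leP (x i) (x j)) => ? [] /andP[? ?] /andP[? ?]; lra.
by move=> /(_ ji jk ik); case: (leP (x i) (x j)) => ? [] /andP[? ?] /andP[? ?]; lra.
Qed.

(** Two nodes with the same image admit no third node, by the strict betweenness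
    in the triple; and on at most two nodes, equal ratios make u a multiple of p,
    which M does not kill. *)
Lemma ratio_injective : injective x.
Proof.
move=> i j xij; apply/eqP; apply: contraT => ij.
have [/existsP[k /andP[ki kj]]|noK] := boolP [exists k, (k != i) && (k != j)].
  have [ik jk] : i != k /\ j != k by split; rewrite eq_sym.
  have ji : j != i by rewrite eq_sym.
  have := e_lin ij ik jk; rewrite !negb_and => /or3P[] /separator_between.
  - by move=> /(_ ik ij kj); rewrite xij => -[] /andP[]; lra.
  - by move=> /(_ ij ik jk); rewrite xij => -[] /andP[]; lra.
  - by move=> /(_ ji jk ik); rewrite xij => -[] /andP[]; lra.
have uE : u = x i *: p.
  apply/matrixP => k l; rewrite ord1 mxE.
  suff -> : x i = x k by rewrite /x divfK // gt_eqF.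
  move: noK; rewrite negb_exists => /forallP/(_ k).
  by rewrite negb_and !negbK => /orP[]/eqP->.
have xi0 : x i = 0.
  have : (M *m u) i 0 = 0 by rewrite u_ker mxE.
  rewrite {1}uE -scalemxAr p_eigen scalerA mxE => /eqP.
  rewrite mulf_eq0 (gt_eqF (p_gt0 i)) orbF mulf_eq0 (lt_eqF lam_lt0) orbF.
  by move/eqP.
by case/eqP: u_neq0; rewrite uE xi0 scale0r.
Qed.
End Line.

(** If two segments overlap, then an end of one lies in the other; two edges with
    a common end a have their other ends on opposite sides of a. *)
Lemma line_embedding_criterion (R : realType) (V : finType) (e : rel V) (x : V -> R) :
    symmetric e -> irreflexive e -> injective x ->
    (forall i j k, e i j -> k != i -> k != j -> ~ in_segment (x i) (x j) (x k)) ->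
  line_embedding e x.
Proof.
move=> e_sym e_irr x_inj x_free.
have x_free' i j k : e i j -> in_segment (x i) (x j) (x k) -> k \in [set i; j].
  move=> eij seg; rewrite !inE; apply: contraT; rewrite negb_or => /andP[ki kj].
  by case: (x_free _ _ _ eij ki kj).
split=> // i j k l eij ekl neq z zij zkl.
have shared a b c : e a b -> e a c -> b != c ->
    in_segment (x a) (x b) z -> in_segment (x a) (x c) z -> z = x a.
  move=> eab eac bc.
  have ba : b != a by apply: contraTneq eab => ->; rewrite e_irr.
  have ca : c != a by apply: contraTneq eac => ->; rewrite e_irr.
  have cb : c != b by rewrite eq_sym.
  have := x_free _ _ _ eab ca cb; have := x_free _ _ _ eac ba bc.
  rewrite /in_segment.
  case: (leP (x a) (x b)) => ?; case: (leP (x a) (x c)) => ? /negP ? /negP ? ? ?; lra.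
have segC a b t : in_segment a b t -> in_segment b a t.
  by rewrite /in_segment minC maxC.
have ij : i != j by apply: contraTneq eij => ->; rewrite e_irr.
have kl : k != l by apply: contraTneq ekl => ->; rewrite e_irr.
have eji : e j i by rewrite e_sym.
have elk : e l k by rewrite e_sym.
have [ik|ik] := eqVneq i k.
  subst k; exists i; first by rewrite !inE eqxx.
  by apply: (shared i j l) => //; apply: contraNneq neq => ->.
have [il|il] := eqVneq i l.
  subst l; exists i; first by rewrite !inE eqxx orbT.
  apply: (shared i j k) => //; last exact: segC.
  by apply: contraNneq neq => ->; rewrite setUC.
have [jk|jk] := eqVneq j k.
  subst k; exists j; first by rewrite !inE eqxx orbT.
  by apply: (shared j i l) => //; exact: segC.
have [jl|jl] := eqVneq j l.
  subst l; exists j; first by rewrite !inE eqxx !orbT.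
  by apply: (shared j i k) => //; exact: segC.
have [ki kj li lj] : [/\ k != i, k != j, l != i & l != j].
  by split; rewrite eq_sym.
have := x_free _ _ _ eij ki kj; have := x_free _ _ _ eij li lj.
have := x_free _ _ _ ekl ik il; have := x_free _ _ _ ekl jk jl.
move: zij zkl; rewrite /in_segment.
case: (leP (x i) (x j)) => ?; case: (leP (x k) (x l)) => ? ? ?
  /negP ? /negP ? /negP ? /negP ?; lra.
Qed.

Section Transport.
Variables (R : realType) (V : finType) (e : rel V).
Hypotheses (e_sym : symmetric e) (e_irr : irreflexive e).

(** The graph carried over to the index set of the matrices. *)
Definition ord_graph : rel 'I_#|V| := [rel i j | e (enum_val i) (enum_val j)].

Lemma ord_graph_sym : symmetric ord_graph.
Proof. by move=> i j; rewrite /ord_graph /= e_sym. Qed.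

Lemma ord_graph_irr : irreflexive ord_graph.
Proof. by move=> i; rewrite /ord_graph /= e_irr. Qed.

Lemma ord_graph_connected : connected_graph e -> connected_graph ord_graph.
Proof.
move=> e_conn i j; rewrite -(enum_valK j).
pose P v := connect ord_graph i (enum_rank v).
apply: (@connect_invariant _ e P (enum_val i)) (e_conn _ (enum_val j)).
  move=> v w iv vw; apply: connect_trans iv (connect1 _).
  by rewrite /ord_graph /= !enum_rankK.
by rewrite /P enum_valK connect0.
Qed.

Lemma signed_on_ord_graph (M : 'M[R]_#|V|) :
  signed_on ord_graph M <-> well_signed e M.
Proof.
split=> [[M_sym M_nonadj M_adj]|[[M_sym M_nonadj] M_adj]].
  split; [split|] => // i j ij eij; [apply: M_nonadj | apply: M_adj];
    by rewrite ?(inj_eq enum_rank_inj) // /ord_graph /= !enum_rankK.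
have entryE i j : M i j = mx_entry M (enum_val i) (enum_val j).
  by rewrite /mx_entry !enum_valK.
by split=> // i j ij eij; rewrite entryE; [apply: M_nonadj | apply: M_adj];
  rewrite ?(inj_eq enum_val_inj).
Qed.

Lemma kappa_linear_triples : kappa R e = 1%N -> linear_triples ord_graph.
Proof.
move=> kappa1 a b c ab ac bc; apply/negP => /and3P[conn_ab conn_ac conn_bc].
have [N [N_signed N_neg N_corank]] :=
  corank_two R ord_graph_sym ab ac bc conn_ab conn_ac conn_bc.
have corank_lt : (corank N < #|V|.+1)%N by rewrite ltnS rank_leq_row.
suff: (corank N <= kappa R e)%N by rewrite kappa1 leqNgt N_corank.
apply: (@leq_bigmax_cond _ _ (fun d : 'I_#|V|.+1 => nat_of_ord d) (Ordinal corank_lt)).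
by apply/asboolP; exists N; split=> //; apply/signed_on_ord_graph.
Qed.
End Transport.

Theorem mainTheorem2 (R : realType) (V : finType) (e : rel V)
  (e_sym : symmetric e) (e_irr : irreflexive e)
  (e_conn : connected_graph e)
  (kappa1 : kappa R e = 1%N)
  (M : 'M[R]_#|V|)
  (M_ws : well_signed e M)
  (M_neg : one_negative_eigenvalue M)
  (M_corank : corank M = 1%N)
  (u : 'cV[R]_#|V|) (u_neq0 : u != 0) (u_ker : M *m u = 0)
  (p : 'cV[R]_#|V|) (p_gt0 : forall i : V, 0 < vec_entry p i)
  (lam : R) (lam_lt0 : lam < 0) (p_eigen : M *m p = lam *: p) :
  line_embedding e (fun i : V => vec_entry u i / vec_entry p i).
Proof.
have g_sym := ord_graph_sym e_sym; have g_irr := ord_graph_irr e_irr.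
have g_conn := ord_graph_connected e_conn.
have g_lin := kappa_linear_triples e_sym kappa1.
have M_signed := (signed_on_ord_graph e M).2 M_ws.
have q_gt0 i : 0 < p i 0 by have := p_gt0 (enum_val i); rewrite /vec_entry enum_valK.
apply: line_embedding_criterion => // [i j eq_x|i j k eij ki kj].
  apply: enum_rank_inj; move: eq_x.
  by apply: (ratio_injective g_sym g_irr g_conn g_lin M_signed M_neg u_neq0 u_ker
    q_gt0 lam_lt0 p_eigen).
apply: (edge_free g_sym g_irr g_conn g_lin M_signed M_neg u_neq0 u_ker
  q_gt0 lam_lt0 p_eigen); rewrite ?(inj_eq enum_rank_inj) //.
by rewrite /ord_graph /= !enum_rankK.
Qed.
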